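(* Let $K$ be a field and let $v=(|\cdot|,A,\mathfrak m,\kappa)$ be a pseudo-absolute value on $K$. Assume that the residue field $\kappa$ is perfect. Let $L/K$ be a Galois extension with Galois group $G$. Denote by $M_{L,v}$ the set of extensions of $v$ to $L$, i.e. of pseudo-absolute values on $L$ whose restriction to $K$ is $v$. Then $G$ acts transitively on $M_{L,v}$.
   Context: A pseudo-absolute value on a field $K$ is a map $|\cdot| : K\to[0,+\infty]$ such that (i) $|1|=1$, $|0|=0$; (ii) $|a+b|\le |a|+|b|$; (iii) $|ab|=|a||b|$ whenever $\{|a|,|b|\}\neq\{0,+\infty\}$. The notation $v=(|\cdot|,A,\mathfrak m,\kappa)$ means that $A=\{a\in K:|a|<+\infty\}$ is its finiteness ring (a valuation ring of $K$), $\mathfrak m=\{a\in A:|a|=0\}$ the maximal ideal of $A$ and $\kappa=A/\mathfrak m$ its residue field. The group $G$ acts on the right on pseudo-absolute values $x$ of $L$: for $\tau\in G$, $x\circ\tau$ is the pseudo-absolute value $a\mapsto|\tau(a)|_x$. *)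

(* Defs.v *)
From HB Require Import structures.
From mathcomp Require Import all_boot all_order all_algebra all_field.
From mathcomp Require Import boolp classical_sets reals constructive_ereal.

Set Implicit Arguments.
Unset Strict Implicit.
Unset Printing Implicit Defensive.

Import Order.TTheory GRing.Theory Num.Theory.

Local Open Scope classical_set_scope.
Local Open Scope ring_scope.

(* In [\bar R] the product [0 * +oo] is [0]; this convention is never used,
   because [pavM] excludes exactly that case. *)
Record pseudo_abs (R : realType) (K : fieldType) := PseudoAbs {
  pav :> K -> \bar R;
  pav_ge0 : forall a, (0 <= pav a)%E;
  pav1 : pav 1 = 1%E;
  pav0 : pav 0 = 0%E;
  pavD : forall a b, (pav (a + b) <= pav a + pav b)%E;
  pavM : forall a b, [set pav a; pav b] <> [set 0%E; +oo%E] ->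
           pav (a * b) = (pav a * pav b)%E
}.

Section PseudoAbsTheory.
Variables (R : realType) (K : fieldType).
Implicit Types (v w : pseudo_abs R K) (a b : K).

Lemma pseudo_abs_ext v w : v =1 w -> v = w.
Proof.
case: v w => [f f1 f2 f3 f4 f5] [g g1 g2 g3 g4 g5] /= /funext fg; subst g.
by congr PseudoAbs; exact: Prop_irrelevance.
Qed.

Lemma pavM_cond v a b :
    ~ (v a = 0%E /\ v b = +oo%E) -> ~ (v a = +oo%E /\ v b = 0%E) ->
  v (a * b) = (v a * v b)%E.
Proof.
move=> n1 n2; apply: pavM => e.
have : [set v a; v b] 0%E by rewrite e; left.
have : [set v a; v b] +oo%E by rewrite e; right.
by move=> [] /= e1 [] /= e2; [move: e2; rewrite -e1 | exact: n2 | exact: n1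
  | move: e2; rewrite -e1].
Qed.

Lemma pavM_fin v a b : (v a < +oo)%E -> (v b < +oo)%E ->
  v (a * b) = (v a * v b)%E.
Proof.
move=> fa fb; apply: pavM_cond => -[ea eb].
  by rewrite eb ltxx in fb.
by rewrite ea ltxx in fa.
Qed.

Lemma pav_lt_pinfty_cases v a : (v a < +oo)%E -> exists2 r, 0 <= r & v a = r%:E.
Proof.
by have := pav_ge0 v a; case: (v a) => // r; rewrite lee_fin => r0 _; exists r.
Qed.

Lemma pavN1 v : v (-1) = 1%E.
Proof.
have : v (-1 * -1) = (v (-1)%R * v (-1)%R)%E.
  by apply: pavM_cond => -[-> ].
rewrite mulrNN mulr1 pav1; have := pav_ge0 v (-1).
case: (v (-1)) => [r||] //=.
  rewrite lee_fin -EFinM => r0 [] e; congr (_%:E).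
  by apply/eqP; rewrite -(@pexpr_eq1 _ r 2) // expr2 -e.
Qed.

Lemma pavN v a : v (- a) = v a.
Proof.
rewrite -mulN1r pavM_cond; first by rewrite pavN1 mul1e.
  by rewrite pavN1 => -[] /eqP; rewrite eqe oner_eq0.
by rewrite pavN1 => -[].
Qed.

End PseudoAbsTheory.

Definition finiteness_pred (R : realType) (K : fieldType) (v : pseudo_abs R K)
  : {pred K} := [pred a | (v a < +oo)%E].

Section FinitenessRing.
Variables (R : realType) (K : fieldType) (v : pseudo_abs R K).

Lemma finiteness_subring_closed : subring_closed (finiteness_pred v).
Proof.
split=> [|a b|a b]; rewrite !inE.
- by rewrite pav1 ltry.
- move=> fa fb; apply: le_lt_trans (pavD v a (- b)) _.
  by rewrite pavN lte_add_pinfty.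
- move=> fa fb; rewrite pavM_fin //.
  have [r _ ->] := pav_lt_pinfty_cases fa.
  by have [s _ ->] := pav_lt_pinfty_cases fb; rewrite -EFinM ltry.
Qed.

HB.instance Definition _ :=
  GRing.isSubringClosed.Build K (finiteness_pred v) finiteness_subring_closed.

Definition finiteness_ring := {a : K | a \in finiteness_pred v}.

HB.instance Definition _ := SubChoice.on finiteness_ring.
HB.instance Definition _ :=
  [SubChoice_isSubComNzRing of finiteness_ring by <:].

Definition null_ideal : {pred finiteness_ring} := [pred a | v (val a) == 0%E].

Lemma null_idealr_closed : idealr_closed null_ideal.
Proof.
split=> [||c x y]; rewrite !inE.
- by rewrite raddf0 pav0.
- by rewrite rmorph1 pav1 eqe oner_eq0.
move=> /eqP x0 /eqP y0; rewrite eq_le pav_ge0 andbT.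
have -> : val (c * x + y) = val c * val x + val y by [].
apply: le_trans (pavD _ _ _) _; rewrite y0 adde0 pavM_fin ?x0 ?mule0 ?ltry //.
exact: (valP c).
Qed.

HB.instance Definition _ :=
  isIdealr.Build finiteness_ring null_ideal null_idealr_closed.

Definition residue_field := {ideal_quot null_ideal}.

HB.instance Definition _ := GRing.ComNzRing.on residue_field.

Local Notation pi := (\pi_residue_field%qT).

Lemma residue_pi_eq0 (a : finiteness_ring) :
  (pi a == 0 :> residue_field) = (v (val a) == 0%E).
Proof.
by rewrite -[0 in LHS](raddf0 pi) eqmodE /= Quotient.equivE subr0.
Qed.

Lemma finiteness_inv (a : K) :
  v a != 0%E -> (v a < +oo)%E -> a^-1 \in finiteness_pred v.
Proof.
move=> na fa; have a0 : a != 0.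
  by apply: contraNneq na => ->; rewrite pav0.
rewrite inE ltey; apply/eqP => e.
have : v (a * a^-1) = (v a * v a^-1%R)%E.
  apply: pavM_cond => -[ea _]; first by rewrite ea eqxx in na.
  by rewrite ea ltxx in fa.
rewrite mulfV // pav1 e gt0_muley //.
by rewrite lt_neqAle eq_sym na pav_ge0.
Qed.

Definition residue_inv (x : residue_field) : residue_field :=
  if x == 0 then 0 else pi (insubd (0 : finiteness_ring) (val (repr x))^-1).

Lemma residue_mulVf x : x != 0 -> residue_inv x * x = 1.
Proof.
move=> x0; rewrite /residue_inv (negbTE x0).
have := x0; rewrite -{1}[x]reprK residue_pi_eq0 => nx.
rewrite -{2}[x]reprK -rmorphM -[1](rmorph1 pi); congr (pi _).
have r0 : val (repr x) != 0.
  by apply: contraNneq nx => r0; rewrite r0 pav0.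
have fr := finiteness_inv nx (valP (repr x)).
by apply: val_inj; rewrite rmorphM rmorph1 /= val_insubd fr mulVf.
Qed.

Lemma residue_inv0 : residue_inv 0 = 0.
Proof. by rewrite /residue_inv eqxx. Qed.

HB.instance Definition _ :=
  GRing.ComNzRing_isField.Build residue_field residue_mulVf residue_inv0.

End FinitenessRing.

Definition perfect_field (F : fieldType) : Prop :=
  forall p : {poly F}, irreducible_poly p -> separable_poly p.

(* The extension is given by its embedding [iota], since [fieldExtType]
   only covers finite extensions. *)
Section GaloisExtensions.
Variables (K L : fieldType) (iota : {rmorphism K -> L}).

Definition algebraic_ext : Prop := forall x : L, algebraicOver iota x.

Definition normal_ext : Prop :=
  forall (p : {poly K}) (x : L),
    irreducible_poly p -> root (map_poly iota p) x ->
    exists rs : seq L, map_poly iota p %= \prod_(z <- rs) ('X - z%:P).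

Definition separable_ext : Prop :=
  forall (p : {poly K}) (x : L),
    irreducible_poly p -> root (map_poly iota p) x -> separable_poly p.

Definition galois_ext : Prop :=
  [/\ algebraic_ext, normal_ext & separable_ext].

Record galois_group := GaloisAut {
  gal_fun :> L -> L;
  gal_zmod : zmod_morphism gal_fun;
  gal_monoid : monoid_morphism gal_fun;
  gal_bij : bijective gal_fun;
  gal_fix : forall a : K, gal_fun (iota a) = iota a
}.

HB.instance Definition _ (s : galois_group) :=
  GRing.isZmodMorphism.Build L L s (gal_zmod s).
HB.instance Definition _ (s : galois_group) :=
  GRing.isMonoidMorphism.Build L L s (gal_monoid s).

HB.instance Definition _ := gen_eqMixin galois_group.
HB.instance Definition _ := gen_choiceMixin galois_group.

Lemma gal_ext (s t : galois_group) : s =1 t -> s = t.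
Proof.
case: s t => [f f1 f2 f3 f4] [g g1 g2 g3 g4] /= /funext fg; subst g.
by congr GaloisAut; exact: Prop_irrelevance.
Qed.

Definition gal_one : galois_group :=
  @GaloisAut idfun (fun _ _ => erefl) (erefl, fun _ _ => erefl)
    (Bijective (fun=> erefl) (fun=> erefl)) (fun=> erefl).

Section Mul.
Variables s t : galois_group.

Lemma gal_mul_fix a : (s \o t) (iota a) = iota a.
Proof. by rewrite /= !gal_fix. Qed.

Definition gal_mul : galois_group :=
  @GaloisAut (s \o t) (raddfB (s \o t))
    (rmorph1 (s \o t), rmorphM (s \o t))
    (bij_comp (gal_bij s) (gal_bij t)) gal_mul_fix.
End Mul.

Section Inv.
Variable s : galois_group.

Lemma gal_inv_ex : exists t : galois_group, cancel s t /\ cancel t s.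
Proof.
have [g sK gK] := gal_bij s.
have gz : zmod_morphism g.
  by move=> x y; apply: (can_inj sK); rewrite raddfB /= !gK.
have gm : monoid_morphism g.
  split; first by apply: (can_inj sK); rewrite rmorph1 /= gK.
  by move=> x y; apply: (can_inj sK); rewrite rmorphM /= !gK.
have gf a : g (iota a) = iota a by rewrite -{1}(gal_fix s) sK.
by exists (GaloisAut gz gm (Bijective gK sK) gf).
Qed.

Definition gal_inv : galois_group := sval (cid gal_inv_ex).

Lemma gal_funK : cancel s gal_inv.
Proof. by rewrite /gal_inv; case: cid => t []. Qed.

Lemma gal_invK : cancel gal_inv s.
Proof. by rewrite /gal_inv; case: cid => t []. Qed.
End Inv.

Lemma gal_mulA : associative gal_mul. Proof. by move=> s t u; apply: gal_ext. Qed.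
Lemma gal_1mul : left_id gal_one gal_mul. Proof. by move=> s; apply: gal_ext. Qed.
Lemma gal_mul1 : right_id gal_one gal_mul. Proof. by move=> s; apply: gal_ext. Qed.
Lemma gal_Vmul : left_inverse gal_one gal_inv gal_mul.
Proof. by move=> s; apply: gal_ext => x; exact: gal_funK. Qed.
Lemma gal_mulV : right_inverse gal_one gal_inv gal_mul.
Proof. by move=> s; apply: gal_ext => x; exact: gal_invK. Qed.

HB.instance Definition _ := isGroup.Build galois_group
  gal_mulA gal_1mul gal_mul1 gal_Vmul gal_mulV.

End GaloisExtensions.

Definition is_right_action (G : groupType) (T : Type) (X : set T)
    (act : T -> G -> T) : Prop :=
  [/\ forall x g, X x -> X (act x g),
      forall x, X x -> act x 1%g = x
    & forall x g h, X x -> act x (g * h)%g = act (act x g) h].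

Definition acts_transitively (G : groupType) (T : Type) (X : set T)
    (act : T -> G -> T) : Prop :=
  is_right_action X act /\
  forall x y, X x -> X y -> exists g, act x g = y.

Definition pav_extensions (R : realType) (K L : fieldType)
    (iota : {rmorphism K -> L}) (v : pseudo_abs R K) : set (pseudo_abs R L) :=
  [set w | forall a : K, w (iota a) = v a].

Section PavAction.
Variables (R : realType) (K L : fieldType) (iota : {rmorphism K -> L}).
Variables (w : pseudo_abs R L) (t : galois_group iota).

Let f (a : L) : \bar R := w (t a).

Lemma pav_act1 : f 1 = 1%E. Proof. by rewrite /f rmorph1 pav1. Qed.
Lemma pav_act0 : f 0 = 0%E. Proof. by rewrite /f raddf0 pav0. Qed.
Lemma pav_actD a b : (f (a + b) <= f a + f b)%E.
Proof. by rewrite /f raddfD pavD. Qed.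
Lemma pav_actM a b : [set f a; f b] <> [set 0%E; +oo%E] ->
  f (a * b) = (f a * f b)%E.
Proof. by move=> h; rewrite /f rmorphM pavM. Qed.

Definition pav_act : pseudo_abs R L :=
  @PseudoAbs R L (fun a => w (t a)) (fun a => pav_ge0 w (t a))
    pav_act1 pav_act0 pav_actD pav_actM.
End PavAction.

(* Main.v *)
Require Import Defs.
From mathcomp Require Import all_boot all_order all_algebra.
From mathcomp Require Import boolp classical_sets reals constructive_ereal.
From HB Require Import structures.
From mathcomp Require Import all_field.
From mathcomp Require Import ring lra.

(** Let [w] and [w'] be two extensions of [v] to [L].  An element of the Galois
    group by which [w] is carried to [w'] is built by extending partial
    isomorphisms: by Zorn's lemma there is a maximal isomorphism between
    subfields [E] and [E'] of [L] over [K] along which [w] pulls back to [w']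
    ([maximal_graph]).  Since [L / K] is normal and separable, it suffices to show that such an isomorphism extends
    from [E] to [E(x)] for every [x] in [L] ([graph_extend]); by symmetry, a
    maximal one is then a bijection of [L].

    The extensions of the isomorphism to [E(x)] correspond to the finitely many
    conjugates [y] of [x] over [E'], and one of them has to preserve the values.
    This rests on two facts.

    First, the values of the roots of a polynomial are determined by the values
    of its coefficients ([newton_root]).  In the non-Archimedean case this is
    the Newton polygon.  For an arbitrary pseudo-absolute value the triangle
    inequality only gives it up to constants, which disappear when the
    polynomial is replaced by those whose roots are the [n]-th powers of its
    roots, [n] going to infinity.  Consequently, for every [z = h(x)] whose
    value is neither 0 nor +oo there is a conjugate [y] of [x] such that
    [h(y)] has the same value, but [y] may depend on [h].

    Second, the choice of [y] can be made uniform.  By algebraicity every nonzero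
    [z] in [E(x)] has a multiple [a z^n], with [n > 0] and [a] in [E], whose
    value is neither 0 nor +oo ([algebraic_pav_unit]); for a given [y], the [z]
    for which such a multiple and its conjugate have the same value form a
    subgroup of the multiplicative group with torsion-free quotient
    ([commensurable]).  These finitely many subgroups cover the whole group, and
    a group is not a finite union of proper subgroups of this kind
    ([pure_cover]).  So one [y] works for all [z], and then the values
    agree everywhere ([commensurable_eq]).

    The argument treats the valuation ring and the absolute value on the residue
    field at once. *)

Set Implicit Arguments.
Unset Strict Implicit.
Unset Printing Implicit Defensive.

Import Order.TTheory GRing.Theory Num.Theory.

Local Open Scope classical_set_scope.
Local Open Scope ring_scope.

(** * Transforming the roots of a polynomial *)

Lemma char_poly_conj (F : fieldType) n (P A : 'M[F]_n) :
  P \in unitmx -> char_poly (P *m A *m invmx P) = char_poly A.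
Proof.
move=> uP; rewrite /char_poly.
have -> : char_poly_mx (P *m A *m invmx P)
    = map_mx polyC P *m char_poly_mx A *m map_mx polyC (invmx P).
  rewrite /char_poly_mx mulmxBr mulmxBl !map_mxM /=; congr (_ - _).
  by rewrite mul_mx_scalar -scalemxAl -map_mxM mulmxV // map_mx1 scalemx1.
rewrite !det_mulmx mulrAC -det_mulmx -map_mxM mulmxV // map_mx1 det1 mul1r.
by [].
Qed.

(** A matrix whose characteristic polynomial has distinct roots is
    diagonalizable, and on a diagonal matrix the claim is a computation. *)
Lemma char_poly_horner_mx (F : fieldType) n (A : 'M[F]_n.+1) (xs : seq F)
    (h : {poly F}) :
    uniq xs -> char_poly A = \prod_(x <- xs) ('X - x%:P) ->
  char_poly (horner_mx A h) = \prod_(x <- xs) ('X - (h.[x])%:P).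
Proof.
move=> uxs cA.
have [P uP /(similar_diagLR uP) [D defA]] :
    exists2 P : 'M_n.+1, P \in unitmx & similar_diag P A.
  by apply/diagonalizableP; exists xs; rewrite -?cA ?mxminpoly_dvd_char.
rewrite conjVmx // in defA.
have eA : A = invmx P *m diag_mx D *m invmx (invmx P) by rewrite invmxK.
have charD (d : 'rV[F]_n.+1) :
    char_poly (diag_mx d) = \prod_(x <- [seq d 0 i | i <- enum 'I_n.+1]) ('X - x%:P).
  rewrite char_poly_trig; last by rewrite diag_mx_is_trig.
  rewrite big_map big_enum; apply: eq_bigr => i _.
  by rewrite mxE eqxx mulr1n.
have uVP : invmx P \in unitmx by rewrite unitmx_inv.
have ehA : horner_mx A h = invmx P *m horner_mx (diag_mx D) h *m invmx (invmx P).
  by rewrite eA horner_mx_uconj.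
rewrite ehA char_poly_conj // horner_mx_diag charD.
move: cA; rewrite eA char_poly_conj // charD => /prod_XsubC_eq pxs.
rewrite -[RHS](big_map (horner h) predT (fun y => 'X - y%:P)).
rewrite -(perm_big _ (perm_map (horner h) pxs)) /= !big_map.
by apply: eq_bigr => i _; rewrite mxE.
Qed.

Lemma companion_exists (F : fieldType) (p : {poly F}) :
  p \is monic -> (1 < size p)%N -> exists n, exists C : 'M[F]_n.+1, char_poly C = p.
Proof.
move=> mp sp; have := companionmxK mp; move: (companionmx p).
case: (size p) sp => [|[|n]] //= _ C <-.
by exists n, C.
Qed.

(** The values of [h] at the roots of [p] are the roots of a polynomial over the
    base field, which is the same for every embedding that splits [p]: the
    characteristic polynomial of [h] of the companion matrix of [p].  This is
    how two embeddings of one field are compared. *)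
Lemma transform_roots (E : fieldType) (p h : {poly E}) :
    p \is monic -> (1 < size p)%N ->
  exists F : {poly E}, forall (L : fieldType) (f : {rmorphism E -> L}) (xs : seq L),
    uniq xs -> map_poly f p = \prod_(x <- xs) ('X - x%:P) ->
    map_poly f F = \prod_(x <- xs) ('X - ((map_poly f h).[x])%:P).
Proof.
move=> mp sp; have [n [C cC]] := companion_exists mp sp.
exists (char_poly (horner_mx C h)) => L f xs uxs pxs.
rewrite map_char_poly map_horner_mx; apply: char_poly_horner_mx => //.
by rewrite -map_char_poly cC.
Qed.

(** * Values under a pseudo-absolute value *)

Section PavTheory.
Variables (R : realType) (L : fieldType) (w : pseudo_abs R L).

Lemma pav_leM a b (c d : R) :
  (w a <= c%:E -> w b <= d%:E -> w (a * b)%R <= (c * d)%R%:E)%E.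
Proof.
move=> ac bd; rewrite pavM_fin ?(le_lt_trans ac) ?(le_lt_trans bd) ?ltry //.
by rewrite EFinM lee_pmul ?pav_ge0.
Qed.

Lemma pav_leD a b (c d : R) :
  (w a <= c%:E -> w b <= d%:E -> w (a + b)%R <= (c + d)%R%:E)%E.
Proof. by move=> ac bd; rewrite (le_trans (pavD w a b)) // EFinD leeD. Qed.

Lemma pav_le_sum (I : Type) (s : seq I) (P : pred I) (f : I -> L) (g : I -> R) :
    (forall i, P i -> (w (f i)%R <= (g i)%R%:E)%E) ->
  (w (\sum_(i <- s | P i) f i)%R <= (\sum_(i <- s | P i) g i)%R%:E)%E.
Proof.
move=> fg; elim/big_rec2: _ => [|i y x Pi]; first by rewrite pav0.
exact/pav_leD/fg.
Qed.

(** Multiplicativity only fails on a product of values 0 and +oo, so it holds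
    unconditionally as soon as one factor has a value in ]0, +oo[. *)
Lemma pavMfin a b r : 0 < r -> w a = r%:E -> w (a * b)%R = (r%:E * w b)%E.
Proof.
move=> r0 ar; rewrite -ar; apply: pavM_cond; rewrite ar => -[] // [] r0'.
by rewrite r0' ltxx in r0.
Qed.

Lemma pav_neq0 a : w a != 0%E -> a != 0.
Proof. by apply: contraNneq => ->; rewrite pav0. Qed.

Lemma pav_fin_neq0 a r : 0 < r -> w a = r%:E -> a != 0.
Proof. by move=> r0 ar; apply: pav_neq0; rewrite ar eqe gt_eqF. Qed.

Lemma pavV_fin a r : 0 < r -> w a = r%:E -> w a^-1 = (r^-1)%:E.
Proof.
move=> r0 ar; have := pavMfin a^-1 r0 ar.
rewrite divff ?(pav_fin_neq0 r0 ar) // pav1.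
case: (w a^-1) => [s||].
- by rewrite -EFinM => -[] e; congr (_%:E); rewrite -[RHS]mulr1 e mulKf ?gt_eqF.
- by rewrite mulry gtr0_sg // mul1e.
- by rewrite mulrNy gtr0_sg // mul1e.
Qed.

Lemma pavV_pinfty a : w a = +oo%E -> w a^-1 = 0%E.
Proof.
move=> aoo; have := pav_ge0 w a^-1; case e: (w a^-1) => [s||] // s0.
  move: s0; rewrite lee_fin le_eqVlt => /orP[/eqP <- //|s0].
  by have := pavV_fin s0 e; rewrite invrK aoo.
have : a != 0 by apply: pav_neq0; rewrite aoo.
move=> /divff a1; have : w (a * a^-1) = (w a * w a^-1%R)%E.
  by apply: pavM_cond; rewrite aoo e => -[].
by rewrite a1 pav1 aoo e.
Qed.

Lemma pav_leX a (c : R) n : (w a <= c%:E -> w (a ^+ n)%R <= (c ^+ n)%R%:E)%E.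
Proof.
move=> ac; elim: n => [|n IH]; first by rewrite !expr0 pav1.
by rewrite !exprS; apply: pav_leM.
Qed.

Lemma pavX a r n : w a = r%:E -> w (a ^+ n)%R = (r ^+ n)%:E.
Proof.
move=> ar; elim: n => [|n IH]; first by rewrite !expr0 pav1.
by rewrite !exprS pavM_fin ?IH ?ar ?ltry.
Qed.

Lemma pavX_pinfty a n : w a = +oo%E -> (0 < n)%N -> w (a ^+ n)%R = +oo%E.
Proof.
move=> aoo; case: n => // n _; elim: n => [//|n IH].
rewrite exprS pavM_cond aoo IH ?mulyy // => -[] //.
Qed.

End PavTheory.

Lemma pavX_inj (R : realType) (L L' : fieldType) (w : pseudo_abs R L)
    (w' : pseudo_abs R L') a b n :
  (0 < n)%N -> w (a ^+ n)%R = w' (b ^+ n) -> w a = w' b.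
Proof.
move=> n0; have := pav_ge0 w a; have := pav_ge0 w' b.
case ea: (w a) => [r||] //; case eb: (w' b) => [s||] //.
- rewrite !lee_fin => s0 r0; rewrite (pavX n ea) (pavX n eb) => -[] e.
  by congr (_%:E); apply/eqP; rewrite -(@eqrXn2 _ n) // e.
- by rewrite (pavX n ea) (pavX_pinfty eb n0).
- by rewrite (pavX n eb) (pavX_pinfty ea n0).
Qed.

(** * Values of roots are determined by the coefficients *)

Section NewtonPolygon.
Variables (R : realType) (L : fieldType) (w : pseudo_abs R L).

(** The weights [rho ^+ k] make the estimate invariant under rescaling of the
    variable: it says that on the circle of radius [rho] the monomial ['X^t]
    dominates [Q - 'X^t] coefficientwise, by a factor [delta]. *)
Definition near_monomial (rho : R) (Q : {poly L}) t (delta : R) :=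
  forall k, (w ((Q - 'X^t)`_k)%R <= (delta * (rho ^+ t / rho ^+ k))%R%:E)%E.

Lemma near_monomial_mulXsubC rho Q t d e s : 0 < rho -> 
    near_monomial rho Q t d -> (w s <= (e * rho)%R%:E)%E ->
  near_monomial rho (Q * ('X - s%:P)) t.+1 ((1 + d) * (1 + e) - 1).
Proof.
move=> rho0 nQ ws k; have rho_n0 : rho != 0 by rewrite gt_eqF.
have ratio0 i j : 0 <= rho ^+ i / rho ^+ j by rewrite divr_ge0 ?exprn_ge0 ?ltW.
have -> : Q * ('X - s%:P) - 'X^(t.+1)
    = (Q - 'X^t) * 'X - s *: (Q - 'X^t) - s *: ('X^t : {poly L}).
  by rewrite exprSr -!mul_polyC; ring.
have -> : ((1 + d) * (1 + e) - 1) * (rho ^+ t.+1 / rho ^+ k)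
   = d * (rho ^+ t.+1 / rho ^+ k) + (e * rho) * (d * (rho ^+ t / rho ^+ k))
     + (e * rho) * (rho ^+ t / rho ^+ k) by rewrite exprS; ring.
have e0 : 0 <= e * rho by rewrite -lee_fin (le_trans (pav_ge0 w s)).
have d0 : 0 <= d.
  have := le_trans (pav_ge0 w _) (nQ t).
  by rewrite lee_fin divff ?mulr1 // expf_neq0.
rewrite !coefB !coefZ !coefMX coefXn.
apply: pav_leD; first apply: pav_leD; rewrite ?pavN.
- case: k => [|k] /=; first by rewrite pav0 lee_fin mulr_ge0.
  have -> : rho ^+ t.+1 / rho ^+ k.+1 = rho ^+ t / rho ^+ k.
    by rewrite !exprS invfM mulrACA divff // mul1r.
  by have := nQ k; rewrite coefB coefXn.
- by apply: pav_leM => //; have := nQ k; rewrite coefB coefXn.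
- apply: pav_leM => //; case: eqP => [->|_]; last first.
    by rewrite pav0 lee_fin.
  by rewrite divff ?expf_neq0 // pav1.
Qed.

Lemma near_monomial_mul1subX rho Q t d e u : 0 < rho -> 
    near_monomial rho Q t d -> (w u <= (e / rho)%R%:E)%E ->
  near_monomial rho (Q * (1 - u *: 'X)) t ((1 + d) * (1 + e) - 1).
Proof.
move=> rho0 nQ ws k; have rho_n0 : rho != 0 by rewrite gt_eqF.
have ratio0 i j : 0 <= rho ^+ i / rho ^+ j by rewrite divr_ge0 ?exprn_ge0 ?ltW.
have -> : Q * (1 - u *: 'X) - 'X^t
    = (Q - 'X^t) - u *: ((Q - 'X^t) * 'X) - u *: ('X^(t.+1) : {poly L}).
  by rewrite exprSr -!mul_polyC; ring.
have -> : ((1 + d) * (1 + e) - 1) * (rho ^+ t / rho ^+ k)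
   = d * (rho ^+ t / rho ^+ k) + (e / rho) * (d * (rho ^+ t.+1 / rho ^+ k))
     + (e / rho) * (rho ^+ t.+1 / rho ^+ k).
  by rewrite exprS; field; rewrite rho_n0 expf_neq0.
have e0 : 0 <= e / rho by rewrite -lee_fin (le_trans (pav_ge0 w u)).
have d0 : 0 <= d.
  have := le_trans (pav_ge0 w _) (nQ t).
  by rewrite lee_fin divff ?mulr1 // expf_neq0.
rewrite !coefB !coefZ !coefMX !coefXn.
apply: pav_leD; first apply: pav_leD; rewrite ?pavN.
- by have := nQ k; rewrite coefB coefXn.
- apply: pav_leM => //; case: k => [|k] /=.
    by rewrite pav0 lee_fin mulr_ge0.
  have -> : rho ^+ t.+1 / rho ^+ k.+1 = rho ^+ t / rho ^+ k.
    by rewrite !exprS invfM mulrACA divff // mul1r.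
  by have := nQ k; rewrite coefB coefXn.
- apply: pav_leM => //; case: eqP => [->|_]; last first.
    by rewrite pav0 lee_fin.
  by rewrite divff ?expf_neq0 // pav1.
Qed.

(** The second alternative bounds the inverse of [z] because [w z] may be
    infinite. *)
Definition away (rho delta : R) (z : L) :=
  (w z <= (delta * rho)%R%:E)%E \/ z != 0 /\ (w z^-1%R <= (delta / rho)%R%:E)%E.

(** A root [z] much smaller than [rho] contributes a factor close to ['X], and a
    root much larger than [rho] a factor [- z *: (1 - z^-1 *: 'X)] close to a
    constant.  Pulling out these constants keeps all the values that occur
    finite; the errors multiply as [1 + delta]. *)
Lemma prod_near_monomial rho delta (zs : seq L) : 0 < rho ->
    {in zs, forall z, away rho delta z} ->
  exists c Q t, [/\ c != 0, \prod_(z <- zs) ('X - z%:P) = c *: Q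
    & near_monomial rho Q t ((1 + delta) ^+ size zs - 1)].
Proof.
move=> rho0; elim: zs => [|z zs IH] zsP.
  exists 1, 1, 0%N; split; rewrite ?oner_neq0 // ?big_nil ?scale1r //.
  by move=> k; rewrite !expr0 !subrr coef0 pav0 mul0r.
have [|c [Q [t [c0 eQ nQ]]]] := IH.
  by move=> x xs; apply: zsP; rewrite inE xs orbT.
have [|wz|[z0 wz]] := zsP z; first by rewrite inE eqxx.
- exists c, (Q * ('X - z%:P)), t.+1; split=> //.
    by rewrite big_cons eQ mulrC scalerAl.
  have := near_monomial_mulXsubC rho0 nQ wz.
  by rewrite [1 + (_ - 1)]addrC subrK -exprSr.
- exists (c * - z), (Q * (1 - z^-1 *: 'X)), t; split.
  + by rewrite mulf_neq0 ?oppr_eq0.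
  + have eX : 'X - z%:P = - z *: (1 - z^-1 *: 'X).
      by rewrite scaleNr scalerBr scalerA divff // scale1r opprB alg_polyC.
    by rewrite big_cons eQ eX -scalerAl -scalerAr scalerA mulrC [Q * _]mulrC.
  have := near_monomial_mul1subX rho0 nQ wz.
  by rewrite [1 + (_ - 1)]addrC subrK -exprSr.
Qed.

End NewtonPolygon.

(** Bernoulli's inequality for the inverse of [e]. *)
Lemma exists_exp_lt (R : realType) (e c : R) :
  0 <= e < 1 -> 0 < c -> exists n, e ^+ n < c.
Proof.
move=> /andP[]; rewrite le_eqVlt => /orP[/eqP <- _ c0|e0 e1 c0].
  by exists 1%N; rewrite expr0n.
have h0 : 0 < e^-1 - 1 by rewrite subr_gt0 invf_gt1.
set h := e^-1 - 1 in h0; have eh : e^-1 = 1 + h by rewrite /h addrC subrK.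
clearbody h.
have bern n : 1 + n%:R * h <= e^-1 ^+ n.
  elim: n => [|n IH]; first by rewrite mul0r addr0.
  rewrite exprS -[n.+1]addn1 natrD.
  have n0 : 0 <= n%:R * (h * h) :> R by rewrite !mulr_ge0 // ltW.
  have h1 : 0 <= 1 + h by rewrite addr_ge0 // ltW.
  have := ler_wpM2l h1 IH; rewrite eh.
  apply: le_trans; rewrite -subr_ge0.
  by have -> : (1 + h) * (1 + n%:R * h) - (1 + (n%:R + 1) * h) = n%:R * (h * h) by ring.
have c0' : 0 < c^-1 by rewrite invr_gt0.
have ch0 : 0 <= c^-1 / h by rewrite divr_ge0 ?ltW.
have := archi_boundP ch0; set n := Num.bound _ => nP; exists n.
rewrite -[e]invrK exprVn -[c]invrK ltf_pV2 ?posrE ?exprn_gt0 ?invr_gt0 //.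
apply: lt_le_trans (bern n); rewrite ltr_pdivrMr // in nP.
by rewrite (lt_le_trans nP) // lerDr.
Qed.

Section Newton.
Variables (R : realType) (E L L' : fieldType).
Variables (w : pseudo_abs R L) (w' : pseudo_abs R L').
Variables (f : {rmorphism E -> L}) (f' : {rmorphism E -> L'}).
Hypothesis agree : forall a, w' (f' a) = w (f a).

(** If [F] has a root of value [rho], the relation that it gives, divided by the
    coefficient of index [t], expresses an element of value [rho ^+ t] as a sum
    of at most [size F] elements of value at most
    [D / (1 - D) * rho ^+ t].  The coefficients only enter through quotients
    in [E], where the two pseudo-absolute values agree. *)
Lemma near_monomial_noroot rho (F : {poly E}) c Q t D u :
    0 < rho -> c != 0 -> map_poly f F = c *: Q ->
    near_monomial w rho Q t D -> (size F).+1%:R * D < 1 ->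
    w' u = rho%:E ->
  ~~ root (map_poly f' F) u.
Proof.
move=> rho0 c0 FQ nQ D1 wu; apply/negP => rFu.
have rho_n0 : rho != 0 by rewrite gt_eqF.
have D0 : 0 <= D.
  by have := le_trans (pav_ge0 w _) (nQ t); rewrite lee_fin divff ?mulr1 ?expf_neq0.
have Dlt1 : D < 1.
  by rewrite (le_lt_trans _ D1) // ler_peMl // ler1n.
have [q q0 wq] : exists2 q : R, 1 - D <= q & w Q`_t = q%:E.
  have Q1 : (w (Q`_t - 1)%R <= D%:E)%E.
    by have := nQ t; rewrite divff ?mulr1 ?expf_neq0 // coefB coefXn eqxx.
  have Q2 : (w (Q`_t) <= (D + 1)%R%:E)%E.
    by rewrite -[Q`_t](subrK 1); apply: pav_leD => //; rewrite pav1.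
  have [q _ wq] := pav_lt_pinfty_cases (le_lt_trans Q2 (ltry _)).
  exists q => //; rewrite lerBlDl -lee_fin -(pav1 w) -{1}(subrK Q`_t 1).
  by apply: pav_leD; rewrite ?wq // -pavN opprB.
have qgt0 : 0 < q by rewrite (lt_le_trans _ q0) // subr_gt0.
have Qt0 := pav_fin_neq0 qgt0 wq.
have coefF k : f F`_k = c * Q`_k by rewrite -coef_map FQ coefZ.
have Ft0 : F`_t != 0 by rewrite -(fmorph_eq0 f) coefF mulf_neq0.
have ltF : (t < size F)%N.
  by rewrite ltnNge; apply: contra Ft0 => tF; rewrite nth_default.
have : f' F`_t != 0 by rewrite fmorph_eq0.
move: rFu; rewrite rootE horner_coef size_map_poly (bigD1 (Ordinal ltF)) //=.
rewrite coef_map /= addr_eq0 => /eqP eFu f'Ft0.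
have : u ^+ t = - \sum_(i < size F | i != Ordinal ltF) f' (F`_i / F`_t) * u ^+ i.
  apply: (mulfI f'Ft0); rewrite eFu mulrN mulr_sumr; congr (- _).
  apply: eq_bigr => i _; by rewrite coef_map /= mulrA -rmorphM [F`_t * _]mulrC divfK.
move/(congr1 w'); rewrite pavN (pavX t wu) => eut.
have : (w' (\sum_(i < size F | i != Ordinal ltF) f' (F`_i / F`_t) * u ^+ i)%R
   <= (\sum_(i < size F | i != Ordinal ltF) (D * rho ^+ t / q))%R%:E)%E.
  apply: pav_le_sum => i it; rewrite -[rho ^+ t](divfK (expf_neq0 i rho_n0)).
  have -> : D * (rho ^+ t / rho ^+ i * rho ^+ i) / q
    = (D * (rho ^+ t / rho ^+ i) * q^-1) * rho ^+ i by ring.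
  apply: pav_leM; last by rewrite (pavX i wu).
  rewrite agree rmorphM fmorphV /= !coefF.
  have -> : c * Q`_i / (c * Q`_t) = Q`_i / Q`_t.
    by rewrite invfM mulrACA divff // mul1r.
  apply: pav_leM; last by rewrite (pavV_fin qgt0 wq).
  have it' : (i == t :> nat) = false := negbTE it.
  by have := nQ i; rewrite coefB coefXn it' subr0.
rewrite -eut lee_fin sumr_const => le_rho.
have : rho ^+ t <= (size F)%:R * (D * rho ^+ t / q).
  apply: le_trans le_rho _; rewrite -[leLHS]mulr_natl ler_wpM2r //.
    by rewrite !mulr_ge0 ?invr_ge0 ?exprn_ge0 // ltW.
  by rewrite ler_nat (leq_trans (max_card _)) // card_ord.
rewrite leNgt => /negP; apply; have rt0 : 0 < rho ^+ t by rewrite exprn_gt0.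
have -> : (size F)%:R * (D * rho ^+ t / q) = rho ^+ t * ((size F)%:R * D / q) by ring.
rewrite -[ltRHS]mulr1 ltr_pM2l // ltr_pdivrMr // mul1r.
rewrite -natr1 mulrDl mul1r in D1.
by rewrite (lt_le_trans _ q0) // ltrBrDr.
Qed.

(** The statement of the Newton polygon that is needed here, valid for
    Archimedean values as well.  If no [y] had value [r], all would be [away]
    from [r] by some factor [e < 1]; passing to [n]-th powers replaces [e] by
    [e ^+ n], which for [n] large beats the constants, depending only on the
    number of roots, that come from the triangle inequality. *)
Lemma newton_root (zs : seq L) (z : L') r : 0 < r -> w' z = r%:E ->
    (forall n, exists2 F : {poly E},
       map_poly f F = \prod_(y <- zs) ('X - (y ^+ n)%:P)
       & root (map_poly f' F) (z ^+ n)) ->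
  exists2 y, y \in zs & w y = r%:E.
Proof.
move=> r0 wz HF; apply: contrapT => nzs.
have [e /andP[e0 e1] eP] : exists2 e : R, 0 <= e < 1 & {in zs, forall y, away w r e y}.
  elim: zs nzs {HF} => [|y zs IH] nzs; first by exists 0; rewrite ?lexx ?ltr01.
  have [|e /andP[e0 e1] eP] := IH.
    by case=> x xs wx; apply: nzs; exists x; rewrite // inE xs orbT.
  have awayW (d d' : R) x : d <= d' -> away w r d x -> away w r d' x.
    move=> dd [wx|[x0 wx]]; [left|right; split=> //]; apply: le_trans wx _.
      by rewrite lee_fin ler_wpM2r // ltW.
    by rewrite lee_fin ler_wpM2r // invr_ge0 ltW.
  have [d /andP[d0 d1] dP] : exists2 d : R, 0 <= d < 1 & away w r d y.
    have ny : w y != r%:E by apply/eqP => wy; apply: nzs; exists y; rewrite ?inE ?eqxx.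
    case ey : (w y) ny => [s||]; last by have := pav_ge0 w y; rewrite ey.
    - rewrite eqe => ny; have s0 : 0 <= s by have := pav_ge0 w y; rewrite ey lee_fin.
      case: (ltP s r) => sr.
        exists (s / r); first by rewrite divr_ge0 ?(ltW r0) // ltr_pdivrMr ?mul1r.
        by left; rewrite divfK ?gt_eqF // ey.
      have rs : r < s by rewrite lt_neqAle eq_sym ny.
      have sgt0 := lt_trans r0 rs; exists (r / s).
        by rewrite divr_ge0 ?(ltW r0) // ltr_pdivrMr ?mul1r.
      right; split; first exact: pav_fin_neq0 sgt0 ey.
      by rewrite (pavV_fin sgt0 ey) mulrAC divff ?gt_eqF // mul1r.
    - move=> _; exists 0; rewrite ?lexx ?ltr01 //; right.
      by rewrite pavV_pinfty // mul0r; split=> //; apply: (@pav_neq0 _ _ w); rewrite ey.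
  exists (Num.max e d); first by rewrite le_max e0 gt_max e1.
  move=> x; rewrite inE => /orP[/eqP -> |xs].
    by apply: awayW dP; rewrite le_max lexx orbT.
  by apply: awayW (eP x xs); rewrite le_max lexx.
(* m.+2%:R bounds the number of terms plus 1, and 2 ^+ m the number of
   subsets of the roots. *)
set m := size zs.
have [n en] : exists n, e ^+ n < (m.+2%:R * 2 ^+ m)^-1.
  by apply: exists_exp_lt; rewrite ?e0 // invr_gt0 mulr_gt0 ?exprn_gt0 ?ltr0n.
have en0 : 0 <= e ^+ n by rewrite exprn_ge0.
have en1 : e ^+ n <= 1 by rewrite exprn_ile1 // ltW.
have [F FP rF] := HF n; move: rF; apply/negP.
have rn0 : 0 < r ^+ n by rewrite exprn_gt0.
have sF : size F = m.+1.
  by rewrite -(size_map_poly f) FP size_prod_XsubC.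
have [|c [Q [t [c0 eQ nQ]]]] :=
    @prod_near_monomial _ _ w (r ^+ n) (e ^+ n) [seq y ^+ n | y <- zs] rn0.
  move=> _ /mapP[y ys ->]; have [wy|[y0 wy]] := eP y ys.
    by left; rewrite -exprMn; apply: pav_leX.
  right; split; first by rewrite expf_neq0.
  by rewrite -exprVn -exprVn -exprMn; apply: pav_leX.
rewrite big_map -FP in eQ; rewrite size_map -/m in nQ.
apply: (near_monomial_noroot rn0 c0 eQ nQ); last exact: pavX.
have bin k : (1 + e ^+ n) ^+ k - 1 <= e ^+ n * (2 ^+ k - 1).
  elim: k => [|k IH]; first by rewrite !subrr mulr0.
  rewrite !exprS; move: IH; set X := _ ^+ k; set Y := 2 ^+ k => IH.
  have Y1 : 0 <= Y - 1 by rewrite subr_ge0 exprn_ege1 // ler1n.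
  have a1 : 0 <= 1 + e ^+ n by rewrite addr_ge0.
  have := ler_wpM2l a1 IH; have := mulr_ge0 en0 (mulr_ge0 Y1 (_ : 0 <= 1 - e ^+ n)).
  by rewrite subr_ge0 => /(_ en1); lra.
have {}bin k : (1 + e ^+ n) ^+ k - 1 <= e ^+ n * 2 ^+ k.
  by apply: le_trans (bin k) _; rewrite ler_wpM2l // gerBl.
rewrite sF (le_lt_trans (ler_wpM2l _ (bin m))) //.
rewrite mulrCA -ltr_pdivlMr ?mulr_gt0 ?exprn_gt0 ?ltr0n //.
by rewrite mul1r.
Qed.
End Newton.

(** * Finite covers by pure subgroups *)

(** A group that is a finite union of subgroups with torsion-free quotients is
    one of them: if [x] lies in the first subgroup only and [y] does not lie in
    it, two of the elements [x ^+ k * y] lie in a common other subgroup, which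
    then contains a power of [x], hence [x].  The statement is about a monoid,
    because it will be applied to polynomials evaluated at a point; the
    hypotheses are what is left of division and purity. *)
Lemma pure_cover (I : eqType) (T : pzSemiRingType) (D : T -> Prop)
    (P : I -> T -> Prop) (s : seq I) :
    D 1 -> (forall x y, D x -> D y -> D (x * y)) ->
    (forall i k x y, P i x -> P i (x ^+ k * y) -> P i y) ->
    (forall i k l x y, (k < l)%N ->
      P i (x ^+ k * y) -> P i (x ^+ l * y) -> P i x) ->
    (forall x, D x -> exists2 i, i \in s & P i x) ->
  exists2 i, i \in s & forall x, D x -> P i x.
Proof.
move=> D1 DM divP pureP; elim: s => [|i s IH] coverP.
  by have [] := coverP 1 D1.
have [Pi|/existsNP [y /not_implyP[Dy nPy]]] := pselect (forall x, D x -> P i x).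
  by exists i; rewrite ?inE ?eqxx.
have [/IH [j js Pj]|/existsNP [x /not_implyP[Dx nPx]]] :=
    pselect (forall x, D x -> exists2 i, i \in s & P i x).
  by exists j; rewrite // inE js orbT.
have Pix : P i x.
  by have [j] := coverP x Dx; rewrite inE => /orP[/eqP ->|js] // Pj;
    case: nPx; exists j.
have DX k : D (x ^+ k * y).
  by apply: (DM) => //; elim: k => [|k IHk] //; rewrite exprS; apply: DM.
have /choice [g gP] (k : 'I_(size s).+1) : exists j : 'I_(size s),
    P (tnth (in_tuple s) j) (x ^+ k * y).
  have [j] := coverP _ (DX k); rewrite inE => /orP[/eqP ->|js] Pj.
    by case: nPy; apply: divP Pj.
  have js' : (index j s < size s)%N by rewrite index_mem.
  by exists (Ordinal js'); rewrite (tnth_nth j) /= nth_index.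
have [/injectiveP/leq_card|] := boolP (injectiveb g); first by rewrite !card_ord ltnn.
move=> /injectivePn [k [l klN gkl]]; case: nPx.
exists (tnth (in_tuple s) (g k)); first exact: mem_tnth.
have := gP l; have := gP k; rewrite -gkl => Pk Pl.
have : k != l :> nat by [].
by rewrite neq_ltn => /orP[kl|kl]; [apply: pureP kl Pk Pl|apply: pureP kl Pl Pk].
Qed.

(** * Extending an embedding by one element *)

Section OneStep.
Variables (R : realType) (E L L' : fieldType).
Variables (w : pseudo_abs R L) (w' : pseudo_abs R L').
Variables (f : {rmorphism E -> L}) (f' : {rmorphism E -> L'}).
Hypothesis agree : forall a, w' (f' a) = w (f a).

Definition same_value (u : L') (t : L) :=
  exists2 r, 0 < r & w' u = r%:E /\ w t = r%:E.

Lemma same_valueM u t u1 t1 :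
  same_value u t -> same_value u1 t1 -> same_value (u * u1) (t * t1).
Proof.
move=> [r r0 [ur tr]] [s s0 [us ts]]; exists (r * s); first exact: mulr_gt0.
by rewrite (pavMfin _ r0 ur) (pavMfin _ r0 tr) us ts.
Qed.

Lemma same_valueV u t : same_value u t -> same_value u^-1 t^-1.
Proof.
move=> [r r0 [ur tr]]; exists r^-1; first by rewrite invr_gt0.
by rewrite (pavV_fin r0 ur) (pavV_fin r0 tr).
Qed.

Lemma same_valueX u t n : same_value u t -> same_value (u ^+ n) (t ^+ n).
Proof.
move=> [r r0 [ur tr]]; exists (r ^+ n); first exact: exprn_gt0.
by rewrite (pavX n ur) (pavX n tr).
Qed.

(** Commensurable pairs form a pure subgroup of the product of the two
    multiplicative groups, although values are not multiplicative: scaling by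
    [a] moves the elements to where they are. *)
Definition commensurable (u : L') (t : L) := exists n a,
  [/\ (0 < n)%N, a != 0 & same_value (f' a * u ^+ n) (f a * t ^+ n)].

Lemma commensurableM u t u1 t1 :
  commensurable u t -> commensurable u1 t1 -> commensurable (u * u1) (t * t1).
Proof.
move=> [n [a [n0 a0 /(same_valueX)vn]]] [m [b [m0 b0 /(same_valueX)vm]]].
exists (n * m)%N, (a ^+ m * b ^+ n); split.
- by rewrite muln_gt0 n0.
- by rewrite mulf_neq0 ?expf_neq0.
have := same_valueM (vn m) (vm n).
rewrite !exprMn -!exprM [(m * n)%N]mulnC.
by congr same_value; rewrite rmorphM !rmorphXn mulrACA.
Qed.

Lemma commensurableV u t : commensurable u t -> commensurable u^-1 t^-1.
Proof.
move=> [n [a [n0 a0 /same_valueV vn]]]; exists n, a^-1; split => //.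
  by rewrite invr_eq0.
by move: vn; congr same_value; rewrite invfM fmorphV exprVn.
Qed.

Lemma commensurableX u t n : commensurable u t -> commensurable (u ^+ n) (t ^+ n).
Proof.
move=> ut; elim: n => [|n IH]; last by rewrite !exprS; apply: commensurableM.
exists 1%N, 1; split; rewrite ?oner_neq0 //.
by exists 1; rewrite // !expr0 !rmorph1 !mulr1 !pav1.
Qed.

Lemma commensurable_root u t n :
  (0 < n)%N -> commensurable (u ^+ n) (t ^+ n) -> commensurable u t.
Proof.
move=> n0 [m [a [m0 a0 v]]]; exists (n * m)%N, a; split=> //.
  by rewrite muln_gt0 n0.
by rewrite !exprM.
Qed.

Lemma commensurable_neq0 u t : commensurable u t -> u != 0 /\ t != 0.
Proof.
move=> [n [a [n0 _ [r r0 [ur tr]]]]]; split.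
  by have := pav_fin_neq0 r0 ur; rewrite mulf_eq0 expf_eq0 n0 negb_or => /andP[].
by have := pav_fin_neq0 r0 tr; rewrite mulf_eq0 expf_eq0 n0 negb_or => /andP[].
Qed.

(** Multiplication by [a^-1] is harmless, as the other factor has a value in
    ]0, +oo[; then the [n]-th powers have equal values. *)
Lemma commensurable_eq u t : commensurable u t -> w' u = w t.
Proof.
move=> [n [a [n0 a0 [r r0 [ur tr]]]]]; apply: (pavX_inj n0).
have fa0 : f a != 0 by rewrite fmorph_eq0.
have fa0' : f' a != 0 by rewrite fmorph_eq0.
rewrite -(mulKf fa0' (u ^+ n)) -(mulKf fa0 (t ^+ n)) ![_^-1 * _]mulrC.
by rewrite (pavMfin _ r0 ur) (pavMfin _ r0 tr) -!fmorphV agree.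
Qed.

End OneStep.

(** The relation [w (y / x) < +oo] is the total preorder of the valuation ring,
    so a finite list has a largest element. *)
Lemma pav_dominant_term (R : realType) (L : fieldType) (w : pseudo_abs R L)
    (x0 : L) (s : seq L) : {in x0 :: s, forall y, y != 0} ->
  exists2 x, x \in x0 :: s & {in x0 :: s, forall y, (w (y / x)%R < +oo)%E}.
Proof.
elim: s x0 => [|x1 s IH] x0 s0.
  exists x0; rewrite ?inE ?eqxx // => y; rewrite inE => /eqP ->.
  by rewrite divff ?pav1 ?ltry // s0 // inE eqxx.
have x00 : x0 != 0 by rewrite s0 // inE eqxx.
have [|x xs xP] := IH x1; first by move=> y ys; apply: s0; rewrite inE ys orbT.
have xn0 : x != 0 by rewrite s0 // inE xs orbT.
have [fin|] := boolP (w (x0 / x)%R < +oo)%E.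
  exists x; first by rewrite inE xs orbT.
  by move=> y; rewrite inE => /orP[/eqP -> //|]; apply: xP.
rewrite -leNgt leye_eq => /eqP /pavV_pinfty; rewrite invf_div => xx0.
exists x0; first by rewrite inE eqxx.
move=> y; rewrite inE => /orP[/eqP ->|/xP yx]; first by rewrite divff // pav1 ltry.
have -> : y / x0 = y / x * (x / x0) by rewrite mulrA divfK.
by rewrite pavM_fin ?xx0 ?mule0 ?ltry.
Qed.

(** The value group of the finiteness ring, a valuation ring, is torsion modulo
    that of the base field: in an algebraic relation, a term of the largest
    order of magnitude cannot be alone, and the quotient of two such terms has
    the required form. *)
Lemma algebraic_pav_unit (R : realType) (E L : fieldType) (w : pseudo_abs R L)
    (f : {rmorphism E -> L}) (u : L) :
    algebraicOver f u -> u != 0 ->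
  exists n a r, [/\ (0 < n)%N, a != 0, 0 < r & w (f a * u ^+ n) = r%:E].
Proof.
move=> [q q0 qu] u0; pose T k := f q`_k * u ^+ k.
have T0 k : (T k == 0) = (q`_k == 0).
  by rewrite mulf_eq0 fmorph_eq0 (negbTE (expf_neq0 _ u0)) orbF.
have [k0 qk0 maxT] : exists2 k0, q`_k0 != 0 & forall k, (w (T k / T k0)%R < +oo)%E.
  pose s := [seq T k | k <- iota 0 (size q) & q`_k != 0].
  have sP x : x \in s -> exists2 k, q`_k != 0 & x = T k.
    by move=> /mapP[k]; rewrite mem_filter => /andP[qk _] ->; exists k.
  have Ts k : q`_k != 0 -> T k \in s.
    move=> qk; apply: map_f; rewrite mem_filter qk mem_iota /= ltnNge.
    by apply: contra qk => kq; rewrite nth_default.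
  have := Ts (size q).-1; rewrite -lead_coefE lead_coef_eq0 q0 => /(_ isT).
  case es: s => [//|x0 s'] _.
  have [|x xs xP] := @pav_dominant_term R L w x0 s'.
    by move=> y; rewrite -es => /sP [k qk ->]; rewrite T0.
  move: xs; rewrite -es => /sP [k qk ex]; exists k => // l.
  have [ql|/Ts ql] := eqVneq q`_l 0; last by rewrite -ex xP // -es.
  by rewrite /T ql rmorph0 !mul0r pav0 ltry.
have Tk0 : T k0 != 0 by rewrite T0.
have ltk0 : (k0 < size q)%N.
  by rewrite ltnNge; apply: contra qk0 => kq; rewrite nth_default.
have [k [kk0 Tk]] : exists k, k != k0 /\ w (T k / T k0) != 0%E.
  apply: contrapT => nk; move: qu; rewrite rootE horner_coef size_map_poly.
  rewrite (bigD1 (Ordinal ltk0)) //= coef_map -/(T k0) addr_eq0 => /eqP eT.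
  have : w (\sum_(i < size q | i != Ordinal ltk0) T i / T k0) = 1%E.
    rewrite -mulr_suml -pavN -mulNr.
    under eq_bigr do rewrite /T -coef_map.
    by rewrite -eT divff // pav1.
  move=> e1; have : (w (\sum_(i < size q | i != Ordinal ltk0) T i / T k0)%R
       <= (\sum_(i < size q | i != Ordinal ltk0) 0 : R)%R%:E)%E.
    apply: pav_le_sum => i ik; rewrite (_ : w _ = 0%E) //.
    by apply/eqP; apply: contrapT => /negP wi; apply: nk; exists (nat_of_ord i); split.
  by rewrite e1 big1 // lee_fin ler10.
have [s s0 ws] : exists2 s : R, 0 < s & w (T k / T k0) = s%:E.
  have [s s0 ws] := pav_lt_pinfty_cases (maxT k); exists s => //.
  by rewrite lt_neqAle s0 andbT; move: Tk; rewrite ws eqe eq_sym.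
have Tk' : T k != 0 by have := pav_fin_neq0 s0 ws; rewrite mulf_eq0 negb_or => /andP[].
have qk : q`_k != 0 by rewrite -T0.
have ratio (i j : nat) : (i < j)%N -> T j / T i = f (q`_j / q`_i) * u ^+ (j - i).
  move=> ij; have ej : u ^+ j = u ^+ (j - i) * u ^+ i.
    by rewrite -exprD subnK // ltnW.
  rewrite /T ej rmorphM fmorphV invfM.
  by rewrite mulrACA mulfK ?expf_neq0.
have [kk|kk|/eqP] := ltngtP k k0; last by rewrite (negbTE kk0).
- exists (k0 - k)%N, (q`_k0 / q`_k), s^-1; split; rewrite ?subn_gt0 ?invr_gt0 //.
    by rewrite mulf_neq0 ?invr_eq0.
  by rewrite -ratio // -invf_div (pavV_fin s0 ws).
- exists (k - k0)%N, (q`_k / q`_k0), s; split; rewrite ?subn_gt0 //.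
    by rewrite mulf_neq0 ?invr_eq0.
  by rewrite -ratio.
Qed.

(** The conjugates [y] of [x] give the embeddings of [E(x)] that extend [f].
    For each single [h], [newton_root] finds a [y] such that [h(x)] and [h(y)]
    are commensurable; by [pure_cover], one [y] serves for all [h]. *)
Lemma extend_one_step (R : realType) (E L L' : fieldType)
    (w : pseudo_abs R L) (w' : pseudo_abs R L')
    (f : {rmorphism E -> L}) (f' : {rmorphism E -> L'}) (p : {poly E})
    (xs : seq L') (ys : seq L) (x : L') :
    (forall a, w' (f' a) = w (f a)) -> p \is monic ->
    uniq xs -> map_poly f' p = \prod_(z <- xs) ('X - z%:P) ->
    uniq ys -> map_poly f p = \prod_(z <- ys) ('X - z%:P) ->
    x \in xs -> (forall h, root (map_poly f' h) x -> p %| h) ->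
  exists2 y, y \in ys & forall h, w' (map_poly f' h).[x] = w (map_poly f h).[y].
Proof.
move=> agree mp uxs pxs uys pys xxs minp.
have sp : (1 < size p)%N.
  rewrite -(size_map_poly f') pxs size_prod_XsubC ltnS lt0n size_eq0.
  by apply: contraTneq xxs => ->.
pose D (h : {poly E}) := (map_poly f' h).[x] != 0.
pose P y (h : {poly E}) :=
  commensurable w w' f f' (map_poly f' h).[x] (map_poly f h).[y].
have hornerXM (F : fieldType) (g : {rmorphism E -> F}) z (h1 h2 : {poly E}) k :
    (map_poly g (h1 ^+ k * h2)).[z] = (map_poly g h1).[z] ^+ k * (map_poly g h2).[z].
  by rewrite rmorphM rmorphXn hornerM horner_exp.
have [|||||y yys yP] := @pure_cover _ {poly E} D P ys.
- by rewrite /D rmorph1 hornerC oner_neq0.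
- by move=> h1 h2 D1 D2; rewrite /D rmorphM hornerM mulf_neq0.
- move=> y k h1 h2; rewrite /P hornerXM hornerXM => P1 P12.
  have [] := commensurable_neq0 P1; set u := _.[x]; set t := _.[y] => u0 t0.
  have := commensurableM (commensurableV (commensurableX k P1)) P12.
  by rewrite !mulKf ?expf_neq0.
- move=> y k l h1 h2 kl; rewrite /P !hornerXM.
  set u := _.[x]; set t := _.[y]; set u2 := _.[x]; set t2 := _.[y] => Pk Pl.
  apply: (@commensurable_root _ _ _ _ _ _ _ _ _ _ (l - k)); rewrite ?subn_gt0 //.
  have [uk0 tk0] := commensurable_neq0 Pk.
  have := commensurableM Pl (commensurableV Pk).
  have splitX (K : fieldType) (z : K) : z ^+ l = z ^+ (l - k) * z ^+ k.
    by rewrite -exprD subnK // ltnW.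
  by rewrite (splitX _ u) (splitX _ t) -[_ * _ * u2]mulrA -[_ * _ * t2]mulrA !mulfK.
- move=> h Dh; have [F0 F0P] := transform_roots h mp sp.
  have algh : algebraicOver f' (map_poly f' h).[x].
    exists F0.
      by rewrite -(map_poly_eq0 f') (F0P _ _ _ uxs pxs) monic_neq0 ?monic_prod_XsubC.
    rewrite (F0P _ _ _ uxs pxs).
    rewrite -(big_map (horner (map_poly f' h)) predT (fun z => 'X - z%:P)).
    by rewrite root_prod_XsubC map_f.
  have [n [a [r [n0 a0 r0 wr]]]] := algebraic_pav_unit w' algh Dh.
  have [|t] := @newton_root R E L L' w w' f f' agree
    [seq (map_poly f (a *: h ^+ n)).[y] | y <- ys] _ r r0 wr.
    move=> m; have [F FP] := transform_roots ((a *: h ^+ n) ^+ m) mp sp.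
    have eval (K : fieldType) (g : {rmorphism E -> K}) z :
      (map_poly g ((a *: h ^+ n) ^+ m)).[z] = (map_poly g (a *: h ^+ n)).[z] ^+ m.
      by rewrite rmorphXn horner_exp.
    exists F.
      rewrite (FP _ _ _ uys pys) big_map; apply: eq_bigr => z _.
      by rewrite eval.
    rewrite (FP _ _ _ uxs pxs).
    rewrite -(big_map (horner (map_poly f' ((a *: h ^+ n) ^+ m))) predT
      (fun z => 'X - z%:P)).
    rewrite root_prod_XsubC; apply/mapP; exists x => //.
    by rewrite eval map_polyZ hornerZ rmorphXn horner_exp.
  move=> /mapP [y yys ->] wy; exists y => //; exists n, a; split=> //.
  exists r => //; split=> //.
  by move: wy; rewrite map_polyZ hornerZ rmorphXn horner_exp.
exists y => // h; have [h0|Dh] := eqVneq (map_poly f' h).[x] 0; last first.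
  exact: commensurable_eq (yP h Dh).
have /dvdpP [g ->] : p %| h by apply: minp; rewrite rootE h0.
rewrite !rmorphM !hornerM.
have -> : (map_poly f' p).[x] = 0 by apply/rootP; rewrite pxs root_prod_XsubC.
have -> : (map_poly f p).[y] = 0 by apply/rootP; rewrite pys root_prod_XsubC.
by rewrite !mulr0 !pav0.
Qed.

(** * Maximal partial isomorphisms *)

Lemma minimal_polynomial (E L : fieldType) (f : {rmorphism E -> L}) (u : L) :
    algebraicOver f u ->
  exists p : {poly E}, [/\ p \is monic, irreducible_poly p, root (map_poly f p) u
    & forall h, root (map_poly f h) u -> p %| h].
Proof.
move=> [q0 q00 rq0].
pose A n := `[< exists q : {poly E}, [/\ q != 0, root (map_poly f q) u & size q = n] >].
have exA : exists n, A n by exists (size q0); apply/asboolP; exists q0.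
have [n /asboolP [q [qn0 rq sq]] minn] := ex_minnP exA.
have minq h : h != 0 -> root (map_poly f h) u -> (size q <= size h)%N.
  by move=> h0 rh; rewrite sq; apply: minn; apply/asboolP; exists h.
have dvdq h : root (map_poly f h) u -> q %| h.
  move=> rh; apply/modp_eq0P; apply: contrapT => /eqP r0.
  have := ltn_modp h q; rewrite qn0 ltnNge minq //.
  have -> : h %% q = h - h %/ q * q by rewrite {2}(divp_eq h q) addrC addKr.
  by rewrite /root rmorphB rmorphM hornerD hornerN hornerM (rootP rh) (rootP rq) mulr0 subrr.
have lq : lead_coef q != 0 by rewrite lead_coef_eq0.
have eqpq : (lead_coef q)^-1 *: q %= q by rewrite eqp_scale ?invr_eq0.
exists ((lead_coef q)^-1 *: q); split.
- by rewrite monicE lead_coefZ mulVf.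
- split=> [|d sd dq].
    rewrite size_scale ?invr_eq0 // ltnNge; apply/negP => /size1_polyC eq.
    move: rq; rewrite eq map_polyC rootC fmorph_eq0 => /eqP c0.
    by rewrite eq c0 eqxx in qn0.
  rewrite (eqp_dvdr _ eqpq) in dq.
  rewrite (eqp_rtrans eqpq) /eqp dq /=; have /dvdpP [g qE] := dq.
  move: rq; rewrite qE rmorphM rootM => /orP[rg|/dvdq]; last by rewrite -qE.
  have [g0 d0] : g != 0 /\ d != 0.
    by apply/andP; rewrite -negb_or -mulf_eq0 -qE.
  have le_g := minq g g0 rg; rewrite qE size_mul // in le_g.
  exfalso; move: sd le_g; rewrite -(size_poly_gt0 g) in g0.
  rewrite -(size_poly_gt0 d) in d0; case: (size d) d0 => [|[|k]] // _ _.
  by rewrite addnS /= -{2}[size g]addn0 leq_add2l.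
- by rewrite map_polyZ rootZ // fmorph_eq0 invr_eq0.
- by move=> h /dvdq; rewrite (eqp_dvdl _ eqpq).
Qed.

(** The graph of an isomorphism between two subfields of [L] over [K] along
    which [w] pulls back to [w'].  No clause says that it is the graph of a function:
    this follows from the compatibility with the values, because 0 has
    value 0 and 1 has value 1. *)
Record valued_graph (R : realType) (K L : fieldType) (iota : {rmorphism K -> L})
    (w' w : pseudo_abs R L) (S : set (L * L)) : Prop := ValuedGraph {
  vg_base : forall a, S (iota a, iota a);
  vg_sub : forall z t, S z -> S t -> S (z - t);
  vg_mul : forall z t, S z -> S t -> S (z * t);
  vg_inv : forall z, S z -> S (z.1^-1, z.2^-1);
  vg_val : forall z, S z -> w' z.1 = w z.2
}.

Section GraphField.
Variables (R : realType) (K L : fieldType) (iota : {rmorphism K -> L}).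
Variables (w' w : pseudo_abs R L) (S : set (L * L)).
Hypothesis vgS : valued_graph iota w' w S.

(** Otherwise (0, 1) or (1, 0) would be in the graph. *)
Lemma vg_eq0 z : S z -> (z.1 == 0) = (z.2 == 0).
Proof.
move=> Sz; have := vg_val vgS (vg_mul vgS Sz (vg_inv vgS Sz)) => /=.
have [->|z1] := eqVneq z.1 0; have [->|z2] := eqVneq z.2 0 => //.
  by rewrite mul0r divff // pav0 pav1 => /esym/eqP; rewrite eqe oner_eq0.
by rewrite mul0r divff // pav0 pav1 => /eqP; rewrite eqe oner_eq0.
Qed.

(** The graph is a subring of [L * L], and by [vg_eq0] a field; its two
    projections are the embeddings to which [extend_one_step] applies.  The
    proof of [valued_graph] is an argument so that the algebraic structures can
    be attached to the predicate. *)
Definition graph_pred of valued_graph iota w' w S : {pred L * L} :=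
  [pred z | `[< S z >]].
Local Notation gp := (graph_pred vgS).

Lemma graph_subring_closed : subring_closed gp.
Proof.
split=> [|z t|z t]; rewrite !inE.
- by have := vg_base vgS 1; rewrite rmorph1.
- by move=> Sz St; apply: (vg_sub vgS Sz St).
- by move=> Sz St; apply: (vg_mul vgS Sz St).
Qed.

HB.instance Definition _ :=
  GRing.isSubringClosed.Build (L * L)%type gp graph_subring_closed.

Definition graph_field := {z : L * L | z \in gp}.
HB.instance Definition _ := SubChoice.on graph_field.
HB.instance Definition _ := [SubChoice_isSubComNzRing of graph_field by <:].

Lemma graphP (z : graph_field) : S (val z).
Proof. by have := valP z; rewrite inE. Qed.

Definition graph_elt z (Sz : S z) : graph_field := Sub z (asboolT Sz).

Definition graph_inv (z : graph_field) : graph_field :=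
  graph_elt (vg_inv vgS (graphP z)).

Lemma graph_mulVf z : z != 0 -> graph_inv z * z = 1.
Proof.
move=> z0; have z12 := vg_eq0 (graphP z).
have z1 : (val z).1 != 0.
  apply: contraNneq z0 => z1; apply/eqP/val_inj.
  move: z12; rewrite z1 eqxx => /esym/eqP z2.
  by rewrite [RHS]raddf0 [LHS]surjective_pairing z1 z2.
have z2 : (val z).2 != 0 by rewrite -z12.
apply: val_inj; rewrite rmorph1.
by rewrite -[LHS]/((val z).1^-1 * (val z).1, (val z).2^-1 * (val z).2) !mulVf.
Qed.

Lemma graph_inv0 : graph_inv 0 = 0.
Proof. by apply: val_inj; rewrite /= !invr0. Qed.

HB.instance Definition _ :=
  GRing.ComNzRing_isField.Build graph_field graph_mulVf graph_inv0.

Definition graph_fst (z : graph_field) : L := (val z).1.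
Definition graph_snd (z : graph_field) : L := (val z).2.
Definition graph_diag (a : K) : graph_field := graph_elt (vg_base vgS a).

Lemma graph_fst_zmod : zmod_morphism graph_fst. Proof. by []. Qed.
Lemma graph_fst_monoid : monoid_morphism graph_fst. Proof. by []. Qed.
Lemma graph_snd_zmod : zmod_morphism graph_snd. Proof. by []. Qed.
Lemma graph_snd_monoid : monoid_morphism graph_snd. Proof. by []. Qed.
Lemma graph_diag_zmod : zmod_morphism graph_diag.
Proof. by move=> a b; apply: val_inj; rewrite /= rmorphB. Qed.
Lemma graph_diag_monoid : monoid_morphism graph_diag.
Proof.
split; first by apply: val_inj; rewrite /= rmorph1.
by move=> a b; apply: val_inj; rewrite /= rmorphM.
Qed.

HB.instance Definition _ :=
  GRing.isZmodMorphism.Build graph_field L graph_fst graph_fst_zmod.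
HB.instance Definition _ :=
  GRing.isMonoidMorphism.Build graph_field L graph_fst graph_fst_monoid.
HB.instance Definition _ :=
  GRing.isZmodMorphism.Build graph_field L graph_snd graph_snd_zmod.
HB.instance Definition _ :=
  GRing.isMonoidMorphism.Build graph_field L graph_snd graph_snd_monoid.
HB.instance Definition _ :=
  GRing.isZmodMorphism.Build K graph_field graph_diag graph_diag_zmod.
HB.instance Definition _ :=
  GRing.isMonoidMorphism.Build K graph_field graph_diag graph_diag_monoid.

Hypothesis galois_LK : galois_ext iota.

(** An embedding over [K] maps the divisors of [m] over [E] to divisors of the
    image of [m] in [L], which is a product of distinct linear factors. *)
Lemma split_over_graph (E : fieldType) (k : {rmorphism K -> E})
    (g : {rmorphism E -> L}) (m : {poly K}) (x : L) (p : {poly E}) :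
    (forall a, g (k a) = iota a) -> irreducible_poly m ->
    root (map_poly iota m) x -> p \is monic -> p %| map_poly k m ->
  exists2 ys : seq L, uniq ys & map_poly g p = \prod_(y <- ys) ('X - y%:P).
Proof.
move=> gk im rm mp pm; have [_ norm sep] := galois_LK.
have [rs eqrs] := norm m x im rm.
have urs : uniq rs.
  by rewrite -separable_prod_XsubC -(eqp_separable eqrs) separable_map; apply: sep rm.
have gpm : map_poly g p %| \prod_(z <- rs) ('X - z%:P).
  rewrite -(eqp_dvdr _ eqrs) -(eq_map_poly gk) map_poly_comp dvdp_map //.
have [b eqb] := dvdp_prod_XsubC gpm.
exists (mask b rs); first exact: mask_uniq.
by apply/eqP; rewrite -eqp_monic ?monic_map ?monic_prod_XsubC.
Qed.

(** The new graph consists of the pairs [(h(x), h(y))], with [y] the conjugate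
    found by [extend_one_step] and [h] any polynomial; it is closed under
    inverses because the minimal polynomial of [x] is irreducible. *)
Lemma graph_extend (x : L) : exists S' : set (L * L),
  [/\ valued_graph iota w' w S', S `<=` S' & exists y, S' (x, y)].
Proof.
have [alg norm sep] := galois_LK.
have [m [mm im rm _]] := minimal_polynomial (alg x).
have rm' : root (map_poly graph_fst (map_poly graph_diag m)) x by rewrite -map_poly_comp.
have [|p [mp ip rp minp]] := @minimal_polynomial _ _ graph_fst x.
  by exists (map_poly graph_diag m); rewrite // map_poly_eq0 irredp_neq0.
have pm := minp _ rm'.
have [xs uxs pxs] := split_over_graph (k := graph_diag) (g := graph_fst)
  (fun=> erefl) im rm mp pm.
have [ys uys pys] := split_over_graph (k := graph_diag) (g := graph_snd)
  (fun=> erefl) im rm mp pm.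
have xxs : x \in xs by move: rp; rewrite pxs root_prod_XsubC.
have agree z : w' (graph_fst z) = w (graph_snd z) by exact: vg_val vgS _ (graphP z).
have [y yys yP] := extend_one_step agree mp uxs pxs uys pys xxs minp.
pose ev (h : {poly graph_field}) : L * L :=
  ((map_poly graph_fst h).[x], (map_poly graph_snd h).[y]).
have evC z : ev z%:P = val z.
  by rewrite /ev !map_polyC !hornerC /= /graph_fst /graph_snd -surjective_pairing.
exists (range ev); split; last 2 first.
- by move=> z Sz; exists (graph_elt Sz)%:P => //; rewrite evC.
- by exists y, 'X => //; rewrite /ev !map_polyX !hornerX.
split.
- by move=> a; exists (graph_diag a)%:P => //; rewrite evC.
- move=> _ _ [h _ <-] [k _ <-]; exists (h - k) => //.
  by rewrite /ev !rmorphB !hornerD !hornerN.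
- move=> _ _ [h _ <-] [k _ <-]; exists (h * k) => //.
  by rewrite /ev !rmorphM !hornerM.
- move=> _ [h _ <-] /=; have [ph|nph] := boolP (p %| h).
    exists 0 => //; rewrite /ev !rmorph0 !horner0; have /dvdpP [k ->] := ph.
    rewrite !rmorphM !hornerM (rootP rp).
    have -> : (map_poly graph_snd p).[y] = 0 by apply/rootP; rewrite pys root_prod_XsubC.
    by rewrite !mulr0 invr0.
  have : coprimep p h.
    apply: contraT => cp; move: nph; rewrite -(eqp_dvdl _ (ip.2 _ cp (dvdp_gcdl p h))).
    by rewrite dvdp_gcdr.
  move=> /Bezout_eq1_coprimepP [[u v] /= uv]; exists v => //.
  have inv (g : {rmorphism graph_field -> L}) z : root (map_poly g p) z ->
      (map_poly g v).[z] = (map_poly g h).[z]^-1.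
    move=> rz; have : (map_poly g (u * p + v * h)).[z] = 1 by rewrite uv rmorph1 hornerC.
    rewrite rmorphD !rmorphM hornerD !hornerM (rootP rz) mulr0 add0r => vh1.
    rewrite -[RHS]mul1r -vh1 mulfK //; apply: contra_eq_neq vh1 => ->.
    by rewrite mulr0 eq_sym oner_eq0.
  by rewrite /ev !inv // pys root_prod_XsubC.
- by move=> _ [h _ <-] /=.
Qed.

End GraphField.

(** Zorn's lemma is used for the sets that are empty or valued graphs, as the
    union of the empty chain is empty. *)
Lemma maximal_graph (R : realType) (K L : fieldType) (iota : {rmorphism K -> L})
    (w' w : pseudo_abs R L) : (forall a, w' (iota a) = w (iota a)) ->
  exists S, valued_graph iota w' w S /\
    forall S', valued_graph iota w' w S' -> S `<=` S' -> S' `<=` S.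
Proof.
move=> agree; pose Good := [set S | S !=set0 -> valued_graph iota w' w S].
have [F FG Ftot|S [goodS maxS]] := @Zorn_bigcup (L * L)%type Good.
  move=> [z0 [X0 FX0 X0z0]].
  have vg X z : F X -> X z -> valued_graph iota w' w X.
    by move=> FX Xz; apply: (FG X FX); exists z.
  have pair z t : (\bigcup_(X in F) X) z -> (\bigcup_(X in F) X) t ->
      exists X, [/\ F X, valued_graph iota w' w X, X z & X t].
    move=> [X FX Xz] [Y FY Yt]; have [XY|YX] := Ftot X Y FX FY.
      by exists Y; split=> //; [apply: vg FY Yt|apply: XY].
    by exists X; split=> //; [apply: vg FX Xz|apply: YX].
  split.
  - by move=> a; exists X0 => //; apply: vg_base (vg X0 z0 FX0 X0z0) a.
  - move=> z t Uz Ut; have [X [FX vX Xz Xt]] := pair z t Uz Ut.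
    by exists X => //; apply: (vg_sub vX).
  - move=> z t Uz Ut; have [X [FX vX Xz Xt]] := pair z t Uz Ut.
    by exists X => //; apply: (vg_mul vX).
  - by move=> z [X FX Xz]; exists X => //; apply: (vg_inv (vg X z FX Xz)).
  - by move=> z [X FX Xz]; apply: (vg_val (vg X z FX Xz)).
have base : valued_graph iota w' w [set (iota a, iota a) | a in [set: K]].
  split.
  - by move=> a; exists a.
  - by move=> _ _ [a _ <-] [b _ <-]; exists (a - b) => //; rewrite !rmorphB.
  - by move=> _ _ [a _ <-] [b _ <-]; exists (a * b) => //; rewrite !rmorphM.
  - by move=> _ [a _ <-]; exists a^-1 => //; rewrite !fmorphV.
  - by move=> _ [a _ <-] /=.
have S0 : S !=set0.
  apply: contrapT => /nonemptyPn S0; apply: (maxS _ _ (fun=> base)).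
  by rewrite S0; split=> [z []|]; apply/existsNP; exists (iota 0, iota 0); case; exists 0.
exists S; split; first exact: goodS.
move=> S' vS' SS'; apply: contrapT => S'S; apply: (maxS S') => //.
Qed.

(** * Transitivity *)

Theorem proposition3p3p4 (R : realType) (K : fieldType) (v : pseudo_abs R K)
  (perfect_kappa : perfect_field (residue_field v))
  (L : fieldType) (iota : {rmorphism K -> L}) (galois_LK : galois_ext iota) :
  acts_transitively (pav_extensions iota v)
    (fun (w : pseudo_abs R L) (t : galois_group iota) => pav_act w t).
Proof.
split.
  split=> [w t wv a|w _|w s t _]; first by rewrite /= gal_fix wv.
    exact: pseudo_abs_ext.
  exact: pseudo_abs_ext.
move=> w w' wv w'v.
have [|S [vS maxS]] := @maximal_graph R K L iota w' w.
  by move=> a; rewrite wv w'v.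
have Sl x : exists y, S (x, y).
  have [S' [vS' SS' [y S'xy]]] := graph_extend vS galois_LK x.
  by exists y; apply: maxS S'xy.
(* The transpose of a valued graph is one for the exchanged values, so S is
   also surjective onto the second factor. *)
have tr (w1 w2 : pseudo_abs R L) (T : set (L * L)) : valued_graph iota w1 w2 T ->
    valued_graph iota w2 w1 [set z | T (z.2, z.1)].
  move=> vT; split.
  - exact: vg_base vT.
  - by move=> z t Tz Tt; apply: (vg_sub vT Tz Tt).
  - by move=> z t Tz Tt; apply: (vg_mul vT Tz Tt).
  - by move=> z Tz; apply: (vg_inv vT Tz).
  - by move=> z /(vg_val vT).
have Sr y : exists x, S (x, y).
  have [S' [vS' SS' [x S'xy]]] := graph_extend (tr _ _ _ vS) galois_LK y.
  exists x; apply: (maxS _ (tr _ _ _ vS')) => // -[a b] Sab; exact: SS'.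
have Sfun x y y' : S (x, y) -> S (x, y') -> y = y'.
  move=> Sxy Sxy'; have := vg_eq0 vS (vg_sub vS Sxy Sxy') => /=.
  by rewrite subrr eqxx => /esym; rewrite subr_eq0 => /eqP.
have Sinj x x' y : S (x, y) -> S (x', y) -> x = x'.
  move=> Sxy Sxy'; have := vg_eq0 vS (vg_sub vS Sxy Sxy') => /=.
  by rewrite subrr eqxx subr_eq0 => /eqP.
have [t tP] := choice Sl; have [t' t'P] := choice Sr.
have tz : zmod_morphism t.
  by move=> a b; apply: Sfun (tP _) (vg_sub vS (tP a) (tP b)).
have tm : monoid_morphism t.
  split; last by move=> a b; apply: Sfun (tP _) (vg_mul vS (tP a) (tP b)).
  by apply: Sfun (tP _) _; have := vg_base vS 1; rewrite rmorph1.
have tb : bijective t.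
  by exists t' => z; [apply: Sinj (t'P _) (tP z)|apply: Sfun (tP _) (t'P z)].
have tf a : t (iota a) = iota a by apply: Sfun (tP _) (vg_base vS a).
exists (GaloisAut tz tm tb tf); apply: pseudo_abs_ext => a /=.
by rewrite -(vg_val vS (tP a)).
Qed.
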